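(* Let $d\ge 1$, $p\ge 1$, and let $x$ be data in $\mathbb{R}^d$ from the density $f(x|\theta,\psi)$ with respect to Lebesgue measure, with $\theta\in\mathbb{R}^p$ and $\psi$ real, both unknown. Let $U_\psi(x,\theta,\psi)=\frac{\partial \log f(x|\theta,\psi)}{\partial\psi}$ be the $\psi$-score and let $\hat\theta$ be the maximum likelihood estimate (MLE) of $\theta$. Assume that: (i) $U_\psi(x,\theta,\psi)\neq 0$ almost surely under $f(\cdot|\theta,\psi)$; (ii) for all $x$ and $\theta$, the equation $U_\psi(x,\theta,\psi)=0$ has a unique solution in $\psi$; (iii) $E_{\theta,\psi}U_\psi(x,\theta,\psi)=0$ for all $\theta,\psi$; (iv) $\psi>0$; (v) $$\log f(x|\theta,\psi)=\frac{C}{A}\log\psi-\frac{D(x,\theta)}{A\psi}+g(x),$$ which implies that $U_\psi(x,\theta,\psi)=\frac{C\psi+D(x,\theta)}{A\psi^2}$, where $C$ is a constant, $D$ is a function with positive values, $A>0$, and $g$ is a real-valued function of $x$. Let $\hat\psi$ be the MLE of $\psi$, obtained from $U_\psi(x,\hat\theta,\hat\psi)=0$. Then $\hat\psi$ is biased for $\psi$.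
   Context: $E_{\theta,\psi}$ denotes expectation with respect to $f(x|\theta,\psi)$. The estimate $\hat\psi$ is biased for $\psi$ if $E_{\theta,\psi}\hat\psi\neq\psi$ for at least one $(\theta,\psi)$. *)

(* Defs.v *)
From HB Require Import structures.
From mathcomp Require Import all_boot all_order all_algebra.
From mathcomp Require Import all_classical all_reals all_analysis.
Set Implicit Arguments.
Unset Strict Implicit.
Unset Printing Implicit Defensive.
Import Order.TTheory GRing.Theory Num.Theory.
Import numFieldNormedType.Exports.
Local Open Scope classical_set_scope.
Local Open Scope ring_scope.

(* Lebesgue measure on R^n, with R^n rendered as n.-tuple R carrying the product
   sigma-algebra. Lebesgue measure on R^(n+1) is the image of the product of
   Lebesgue measures on R and R^n under (a, t) |-> a :: t. *)
Section LebesgueTuple.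
Variable R : realType.

Definition tcons n (u : measurableTypeR R * n.-tuple R) : n.+1.-tuple R :=
  [tuple of u.1 :: u.2].

Lemma measurable_tcons n : measurable_fun setT (@tcons n).
Proof. exact: (@measurable_cons _ _ (measurableTypeR R * n.-tuple R)%type R). Qed.

Section step.
Variables (n : nat) (mu : {sigma_finite_measure set (n.-tuple R) -> \bar R}).

Definition lebesgue_step : set (n.+1.-tuple R) -> \bar R :=
  pushforward (lebesgue_measure \x mu)%E (@tcons n).

Let preim_tcons A : measurable A -> measurable (@tcons n @^-1` A).
Proof. by move=> mA; rewrite -[X in measurable X]setTI; exact: measurable_tcons. Qed.

Let step0 : lebesgue_step set0 = 0%E.
Proof. by rewrite /lebesgue_step /pushforward preimage_set0 measure0. Qed.

Let step_ge0 A : (0 <= lebesgue_step A)%E.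
Proof. by rewrite /lebesgue_step /pushforward; exact: measure_ge0. Qed.

Let step_sigma_additive : semi_sigma_additive lebesgue_step.
Proof.
move=> F mF tF mUF; rewrite /lebesgue_step /pushforward preimage_bigcup.
apply: measure_semi_sigma_additive.
- by move=> k; exact: preim_tcons.
- apply/trivIsetP => /= i j _ _ ij; rewrite -preimage_setI.
  by move/trivIsetP : tF => /(_ _ _ _ _ ij) ->//; rewrite preimage_set0.
- by rewrite -preimage_bigcup; exact: preim_tcons.
Qed.

HB.instance Definition _ :=
  isMeasure.Build _ _ _ lebesgue_step step0 step_ge0 step_sigma_additive.

(* Proved by hand: the library's instance for \x on sigma-finite measures is
   shadowed by the one for finite measures. *)
Lemma lebesgue_step_sigma_finite : sigma_finite setT lebesgue_step.
Proof.
pose leb1 : {sigma_finite_measure set (measurableTypeR R) -> \bar R} :=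
  lebesgue_measure.
have /sigma_finiteP[F [TF ndF Foo]] := sigma_finiteT leb1.
have /sigma_finiteP[G [TG ndG Goo]] := sigma_finiteT mu.
pose s (x : n.+1.-tuple R) : measurableTypeR R * n.-tuple R :=
  (thead x, [tuple of behead x]).
have ms : measurable_fun setT s.
  apply/measurable_fun_pair; last exact: measurable_behead.
  exact: measurable_tnth.
exists (fun k => s @^-1` (F k `*` G k)) => [|k].
  apply/seteqP; split => // x _.
  have [i _ Fi] : (\bigcup_k F k) (s x).1 by rewrite -TF.
  have [j _ Gj] : (\bigcup_k G k) (s x).2 by rewrite -TG.
  exists (maxn i j) => //; split => /=.
  - by move: Fi; exact/subsetPset/ndF/leq_maxl.
  - by move: Gj; exact/subsetPset/ndG/leq_maxr.
have [mF Fk] := Foo k; have [mG Gk] := Goo k; split.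
  by rewrite -[X in measurable X]setTI; apply: ms => //; exact: measurableX.
rewrite /lebesgue_step /pushforward -comp_preimage (_ : s \o _ = id); last first.
  by apply/funext => -[a t]; rewrite /s /tcons /= theadE; congr pair; apply/val_inj.
by rewrite preimage_id product_measure1E// lte_mul_pinfty// ge0_fin_numE.
Qed.

HB.instance Definition _ :=
  @Measure_isSigmaFinite.Build _ _ _ lebesgue_step lebesgue_step_sigma_finite.
End step.

Fixpoint lebesgue_tuple n : {sigma_finite_measure set (n.-tuple R) -> \bar R} :=
  match n with
  | 0 => \d_([tuple] : 0.-tuple R)
  | m.+1 => lebesgue_step (lebesgue_tuple m)
  end.

Lemma lebesgue_tuple_box n (A : 'I_n -> set R) :
  (forall i, measurable (A i)) ->
  lebesgue_tuple n [set x | forall i, A i (tnth x i)] =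
  (\prod_(i < n) lebesgue_measure (A i))%E.
Proof.
elim: n A => [|n IH] A mA.
  rewrite big_ord0 [LHS](_ : _ = \d_([tuple] : 0.-tuple R)
    [set x | forall i, A i (tnth x i)]) // diracE mem_set //.
  by case.
rewrite big_ord_recl /= /lebesgue_step /pushforward -IH//.
set B := [set x : n.-tuple R | _].
have mB : measurable B.
  rewrite (_ : B = \bigcap_(i in setT) ((@tnth n R ^~ i) @^-1` A (lift ord0 i))).
    apply: fin_bigcap_measurable => // i _; rewrite -[X in measurable X]setTI.
    exact: measurable_tnth.
  by apply/seteqP; split => [x h i _|x h i]; exact: h.
have tE a (t : n.-tuple R) i : tnth (tcons (a, t)) (lift ord0 i) = tnth t i.
  by rewrite tnthS; congr (tnth _ _); apply/val_inj.
rewrite [X in _ X = _](_ : _ = A ord0 `*` B); last first.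
  apply/seteqP; split => -[a t] /= h.
    by split; [exact: (h ord0)|move=> i; rewrite -(tE a); exact: h].
  move=> i; have [j ->|->] := unliftP ord0 i; last by case: h.
  by rewrite tE; case: h.
by rewrite product_measure1E//; exact: mA.
Qed.
End LebesgueTuple.

Section ParametricModel.
Context d (T : measurableType d) (R : realType) (Theta : Type).

Definition is_density (mu : {measure set T -> \bar R}) (P : probability T R)
    (h : T -> R) : Prop :=
  [/\ measurable_fun setT h, (forall x, 0 <= h x) &
      forall A, measurable A -> P A = (\int[mu]_(x in A) (h x)%:E)%E].

Implicit Types (f : T -> Theta -> R -> R) (P : Theta -> R -> probability T R).

Definition psi_score f (x : T) (theta : Theta) (psi : R) : R :=
  derive1 (fun s => ln (f x theta s)) psi.

(* The parameter space is Theta x ]0, +oo[. "The" MLE is the unique maximizer of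
   the likelihood, whence the strict inequality. *)
Definition is_MLE f (theta_hat : T -> Theta) (psi_hat : T -> R) : Prop :=
  forall x, 0 < psi_hat x /\
    forall theta psi, 0 < psi -> (theta, psi) <> (theta_hat x, psi_hat x) ->
      f x theta psi < f x (theta_hat x) (psi_hat x).

Definition biased P (psi_hat : T -> R) : Prop :=
  exists theta psi, 0 < psi /\ ('E_(P theta psi)[psi_hat])%E <> (psi%:E)%E.

End ParametricModel.

(* Main.v *)
Require Import Defs.
From HB Require Import structures.
From mathcomp Require Import all_boot all_order all_algebra.
From mathcomp Require Import all_classical all_reals all_analysis.
From mathcomp Require Import measurable_realfun ring lra.
Set Implicit Arguments.
Unset Strict Implicit.
Unset Printing Implicit Defensive.
Import Order.TTheory GRing.Theory Num.Theory.
Import numFieldNormedType.Exports.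
Local Open Scope classical_set_scope.
Local Open Scope ring_scope.

(** The score equation gives [D x (theta_hat x) = - C * psi_hat x], so [C < 0],
    and since the MLE strictly maximizes the likelihood,
    [psi_hat x <= D x theta / - C], with equality only if [theta = theta_hat x].
    By (iii) the right-hand side has mean [psi] under [P theta psi]. If [psi_hat]
    were unbiased, equality would hold almost surely, i.e. [theta_hat = theta]
    [P theta psi]-a.s. for every [theta]. The densities being positive, all the
    [P theta psi] have the same null sets, which is absurd as soon as there are
    two distinct values of [theta]. *)

(** Computes the [psi]-score from (v). The formula for [l] is given only on the positive half-line,
    but this is a neighbourhood of [t], and the derivative depends only on values near [t]. *)
Lemma derive1_ln_inv_cst (R : realType) (l : R -> R) (a b c t : R) : 0 < t ->
  (forall s, 0 < s -> l s = a * ln s - b / s + c) ->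
  derive1 l t = (a * t + b) / t ^+ 2.
Proof.
move=> t0 lE; have tn0 : t != 0 by rewrite gt_eqF.
have dln := is_derive1_ln t0.
have dinv := is_deriveV tn0 (is_derive_id t 1).
rewrite derive1E (@near_eq_derive _ _ _ _ (fun s => a * ln s - b / s + c)).
  have d := is_deriveD (is_deriveB (is_deriveZ a dln) (is_deriveZ b dinv))
    (is_derive_cst c t 1).
  rewrite (_ : (fun s => _) =
    (a \*: ln (R := R) - b \*: (fun y => (id y)^-1)) + cst c); last exact/funext.
  rewrite (@derive_val _ _ _ _ _ _ _ d) /GRing.scale /=; field.
  exact: tn0.
near=> s; apply: lE; near: s; exact: lt_nbhsr.
Unshelve. all: by end_near.
Qed.

(** [Y - X] is nonnegative with zero integral, hence vanishes almost surely; [X] is integrable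
    because [Y] dominates it. *)
Lemma ae_eq_of_le_expectation d (T : measurableType d) (R : realType)
    (P : probability T R) (X Y : T -> R) :
  measurable_fun setT X -> P.-integrable setT (EFin \o Y) ->
  (forall x, 0 <= X x <= Y x) -> ('E_P[X] = 'E_P[Y])%E ->
  {ae P, forall x, X x = Y x}.
Proof.
move=> mX iY XY EXY.
have iX : P.-integrable setT (EFin \o X).
  apply: le_integrable iY => //; first exact/measurable_EFinP.
  move=> x _ /=; have /andP[X0 leXY] := XY x.
  by rewrite lee_fin !ger0_norm// (le_trans X0).
have iYX := integrableB measurableT iY iX.
have : (\int[P]_x `|(Y x)%:E - (X x)%:E| = 0)%E.
  under eq_integral => x _.
    rewrite gee0_abs; last by rewrite -EFinB lee_fin subr_ge0; case/andP: (XY x).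
    over.
  rewrite integralB_EFin//; move: EXY; rewrite unlock => ->.
  by rewrite subee// integrable_fin_num.
move/(ae_eq_integral_abs P measurableT (measurable_int _ iYX)).
by apply: filterS => x /(_ I) /= /eqP; rewrite -EFinB eqe subr_eq0 => /eqP.
Qed.

(** A [Q]-null set [B] has a zero integral of the positive function [k], so [mu B = 0], and then
    [P B], an integral over [B], vanishes too. *)
Lemma negligible_positive_density d (T : measurableType d) (R : realType)
    (mu : {measure set T -> \bar R}) (P Q : probability T R) (h k : T -> R) :
  is_density mu P h -> is_density mu Q k -> (forall x, 0 < k x) ->
  forall N : set T, Q.-negligible N -> P.-negligible N.
Proof.
move=> [mh h0 Ph] [mk k0 Qk] kpos N [B [mB QB NB]].
exists B; split => //; rewrite Ph//.
have mkB : measurable_fun B (EFin \o k).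
  by apply/measurable_EFinP; apply: measurable_funTS.
apply: null_set_integral => //.
  by apply/measurable_EFinP; apply: measurable_funTS.
move: QB; rewrite Qk// => QB.
have : (\int[mu]_(x in B) `|(EFin \o k) x| = 0)%E.
  rewrite -[RHS]QB; apply: eq_integral => x _ /=.
  by rewrite ger0_norm.
move/(ae_eq_integral_abs mu mB mkB) => [E [mE muE BE]].
apply/eqP; rewrite -measure_le0 -muE le_measure ?inE// => x Bx.
apply: BE => /= /(_ Bx) [] kx; by have := kpos x; rewrite kx ltxx.
Qed.

Theorem proposition2p3 (R : realType) (d p : nat) (d_ge1 : (1 <= d)%N)
    (p_ge1 : (1 <= p)%N)
    (f : d.-tuple R -> p.-tuple R -> R -> R)
    (P : p.-tuple R -> R -> probability (d.-tuple R) R)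
    (f_density : forall theta psi, 0 < psi ->
       is_density (lebesgue_tuple R d) (P theta psi) (fun x => f x theta psi))
    (* (i) *)
    (score_neq0 : forall theta psi, 0 < psi ->
       {ae P theta psi, forall x, psi_score f x theta psi <> 0})
    (* (ii) *)
    (score_root : forall x theta,
       exists! psi, 0 < psi /\ psi_score f x theta psi = 0)
    (* (iii) *)
    (score_mean : forall theta psi, 0 < psi ->
       (P theta psi).-integrable setT
         (fun x => (psi_score f x theta psi)%:E) /\
       ('E_(P theta psi)[fun x => psi_score f x theta psi] = 0)%E)
    (* (v) *)
    (C A : R) (A_gt0 : 0 < A) (D : d.-tuple R -> p.-tuple R -> R)
    (D_gt0 : forall x theta, 0 < D x theta) (g : d.-tuple R -> R)
    (log_f : forall x theta psi, 0 < psi ->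
       0 < f x theta psi /\
       ln (f x theta psi) = C / A * ln psi - D x theta / (A * psi) + g x)
    (theta_hat : d.-tuple R -> p.-tuple R) (psi_hat : d.-tuple R -> R)
    (psi_hat_meas : measurable_fun setT psi_hat)
    (hat_MLE : is_MLE f theta_hat psi_hat)
    (hat_score : forall x, psi_score f x (theta_hat x) (psi_hat x) = 0) :
  biased P psi_hat.
Proof.
have A_neq0 : A != 0 by rewrite gt_eqF.
have scoreE x theta psi : 0 < psi ->
    psi_score f x theta psi = (C / A * psi + D x theta / A) / psi ^+ 2.
  move=> psi0; apply: (derive1_ln_inv_cst (c := g x)) => // s s0.
  by rewrite (log_f _ _ _ s0).2 invfM mulrA.
have psi_hat_gt0 x : 0 < psi_hat x := (hat_MLE x).1.
have hatE x : D x (theta_hat x) = - C * psi_hat x.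
  have := hat_score x; rewrite scoreE// => /eqP.
  rewrite mulf_eq0 invr_eq0 expf_eq0/= (gt_eqF (psi_hat_gt0 x)) orbF.
  rewrite mulrAC -mulrDl mulf_eq0 invr_eq0 (negPf A_neq0) orbF.
  by move=> /eqP h; lra.
(* Both [D] and [psi_hat] are positive in [hatE]; the zero vector is just some data point at which
   to read off the sign. *)
have C_lt0 : C < 0.
  have := D_gt0 [tuple of nseq d 0] (theta_hat [tuple of nseq d 0]).
  by rewrite hatE pmulr_lgt0// oppr_gt0.
(* Compare the likelihoods at [theta] and [theta_hat x] for the same [psi], namely [psi_hat x]: the
   terms in [C] and [g] cancel, and what remains is decreasing in [D]. *)
have D_hat_lt x theta : theta <> theta_hat x -> D x (theta_hat x) < D x theta.
  move=> neq; have ps0 := psi_hat_gt0 x.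
  have := (hat_MLE x).2 theta (psi_hat x) ps0.
  move=> /(_ (fun e => neq (congr1 fst e))).
  rewrite -ltr_ln ?posrE ?(log_f _ _ _ ps0).1//.
  rewrite !(log_f _ _ _ ps0).2 ltrD2r ltrD2l ltrN2 ltr_pM2r//.
  by rewrite invr_gt0 mulr_gt0.
apply: contrapT => unbiased.
(* Unbiasedness is used at the single value [psi = 1], with [theta] free. *)
have hat_mean theta : ('E_(P theta 1%R)[psi_hat] = 1)%E.
  by apply: contrapT => E; apply: unbiased; exists theta, 1.
have theta_hat_ae theta : {ae P theta 1, forall x, theta_hat x = theta}.
  have [iU EU] := score_mean theta 1 ltr01.
  (* At [psi = 1] the score is [(C + D x theta) / A], so this affine function of it equals
     [D x theta / - C]; written this way, its integrability and its mean 1 follow from (iii). *)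
  pose Y := cst 1 \- (A / C \o* (fun x => psi_score f x theta 1)).
  have YE x : Y x = D x theta / - C.
    rewrite /Y /= scoreE//; field.
    by rewrite A_neq0 lt_eqF.
  have L1 : cst (1 : R) \in Lfun (P theta 1) 1 by exact: Lfun_cst.
  have Ls : (fun x => psi_score f x theta 1) \in Lfun (P theta 1) 1.
    exact/Lfun1_integrable.
  have LZ : (A / C \o* (fun x => psi_score f x theta 1)) \in Lfun (P theta 1) 1.
    exact: Lfun_scale.
  have iY : (P theta 1).-integrable setT (EFin \o Y).
    by apply/Lfun1_integrable; rewrite rpredB.
  have EY : ('E_(P theta 1%R)[Y] = 1)%E.
    by rewrite expectationB// expectationZl// EU mule0 sube0 expectation_cst.
  have hatY x : 0 <= psi_hat x <= Y x.
    rewrite (ltW (psi_hat_gt0 x)) YE ler_pdivlMr ?oppr_gt0// mulrC -hatE /=.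
    by have [->//|/D_hat_lt/ltW//] := pselect (theta = theta_hat x).
  have := ae_eq_of_le_expectation psi_hat_meas iY hatY
    (etrans (hat_mean theta) (esym EY)).
  (* Where [psi_hat x = Y x], [hatE] gives equal values of [D] at [theta] and [theta_hat x], against
     the strict inequality unless the two coincide. *)
  apply: filterS => x; rewrite YE => e; apply: contrapT => /nesym/D_hat_lt.
  rewrite hatE e mulrC divfK ?ltxx//.
  by rewrite oppr_eq0 lt_eqF.
(* Two parameters that differ in their first coordinate, which exists since [p >= 1]. *)
pose t0 : p.-tuple R := [tuple of nseq p 0].
pose t1 : p.-tuple R := [tuple of nseq p 1].
have t01 : t0 <> t1.
  move=> /(congr1 (fun t => tnth t (Ordinal p_ge1))).
  by rewrite !tnth_nseq => /eqP; rewrite eq_sym oner_eq0.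
have N1 : {ae P t0 1, forall x, theta_hat x = t1}.
  apply: (negligible_positive_density (f_density t0 1 ltr01)
    (f_density t1 1 ltr01)) (theta_hat_ae t1) => x.
  exact: (log_f x t1 1 ltr01).1.
have : (P t0 1).-negligible setT.
  (* Every [x] lies in one of the two exceptional sets, since [theta_hat x] cannot equal both [t0]
     and [t1]. *)
  apply: negligibleS (negligibleU (theta_hat_ae t0) N1) => x _ /=.
  have [e|] := pselect (theta_hat x = t0); last by left.
  by right; rewrite e.
move/(negligibleP (P t0 1) measurableT) => PT.
by have := probability_setT (P t0 1); rewrite PT => /esym/eqP; rewrite onee_eq0.
Qed.
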